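(* Let $\mathbf{X}\in\mathbb{R}^{n\times p}$, $\beta^*\in\mathbb{R}^p$, $\varepsilon\in\mathbb{R}^n$ and $y=\mathbf{X}\beta^*+\varepsilon$. Let $h:\mathbb{R}^p\to[0,+\infty]$ be a convex, proper function such that the minimization problem $\min_{\beta\in\mathbb{R}^p}\|\mathbf{A}\beta-z\|^2+2h(\beta)$ has at least one solution for every $z\in\mathbb{R}^n$ and every $\mathbf{A}\in\mathbb{R}^{n\times p}$, and let $\hat\beta\in\operatorname*{argmin}_{\beta\in\mathbb{R}^p}\|\mathbf{X}\beta-y\|^2+2h(\beta)$. Assume that $h(\beta^* )<+\infty$. Let $\alpha\in(0,1)$ and let $r>0$. If $$H\big((1-\alpha)r\big)\le(1+\alpha^2)r\qquad\text{and}\qquad H\big((1-\alpha^2)r\big)\ge r,$$ then $\|\mathbf{X}(\hat\beta-\beta^* )\|\ge(1-\alpha)r$.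
   Context: $\|\cdot\|$ is the Euclidean norm. A function is proper if it is finite at at least one point. The function $H:(0,+\infty)\to\mathbb{R}$ (which depends on $\varepsilon$) is defined by $$H(t)=\sup_{\beta\in\mathbb{R}^p:\ \|\mathbf{X}(\beta-\beta^* )\|\le t}\frac{\varepsilon^T\mathbf{X}(\beta-\beta^* )+h(\beta^* )-h(\beta)}{t},\qquad t>0.$$ *)

(* Defs.v *)
From mathcomp Require Import all_boot all_order all_algebra.
From mathcomp Require Import all_classical all_reals ereal.

Set Implicit Arguments.
Unset Strict Implicit.
Unset Printing Implicit Defensive.

Import Order.TTheory GRing.Theory Num.Theory.

Local Open Scope ring_scope.
Local Open Scope classical_set_scope.
Local Open Scope ereal_scope.

(* [`|v|] on matrices is the sup norm in MathComp-Analysis, hence a separate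
   Euclidean norm. *)
Definition enorm (R : realType) (n : nat) (v : 'cV[R]_n) : R :=
  Num.sqrt (\sum_(i < n) v i 0%R ^+ 2)%R.

Definition proper_fun (R : realType) (T : Type) (h : T -> \bar R) : Prop :=
  exists x, h x \is a fin_num.

(* Only used for functions with values in [0, +oo], so that [+] on the
   right-hand side never meets +oo - oo.  The convention 0 * +oo = 0 makes
   the endpoints t = 0 and t = 1 harmless. *)
Definition econvex (R : realType) (p : nat) (h : 'cV[R]_p -> \bar R) : Prop :=
  forall (a b : 'cV[R]_p) (t : R), (0 <= t <= 1)%R ->
    h (t *: a + (1 - t) *: b)%R <= t%:E * h a + (1 - t)%:E * h b.

Definition is_argmin (R : realType) (T : Type) (f : T -> \bar R) (x : T) : Prop :=
  forall x', f x <= f x'.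

Definition penalized_ls (R : realType) (n p : nat) (A : 'M[R]_(n, p))
    (z : 'cV[R]_n) (h : 'cV[R]_p -> \bar R) (b : 'cV[R]_p) : \bar R :=
  (enorm (A *m b - z) ^+ 2)%:E + 2%:E * h b.

(* The supremum is taken in \bar R because h may take the value +oo, in which
   case the quotient below is -oo.  When h >= 0, h bstar < +oo and t > 0, the
   value is a real number: b = bstar contributes 0, and by Cauchy-Schwarz every
   quotient is at most enorm eps + h bstar / t. *)
Definition Hfun (R : realType) (n p : nat) (X : 'M[R]_(n, p))
    (bstar : 'cV[R]_p) (eps : 'cV[R]_n) (h : 'cV[R]_p -> \bar R) (t : R) : \bar R :=
  ereal_sup [set (((eps^T *m (X *m (b - bstar))) 0 0)%R%:E + h bstar - h b)
                 * (t^-1)%:E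
            | b in [set b | (enorm (X *m (b - bstar)) <= t)%R]].

(* Main.v *)
Require Import Defs.
From mathcomp Require Import all_boot all_order all_algebra.
From mathcomp Require Import all_classical all_reals ereal.
From mathcomp Require Import ring lra.

(** Put [u b = X (b - bstar)], [phi b = <eps, u b> + h bstar - h b] and
    [G t = t H(t)], the supremum of [phi] over [|u b| <= t], which is concave.
    First-order optimality of [bhat] bounds the slope of [G] to the right of
    [that = |u bhat|] by [that].  The two hypotheses on [H] say that the chord
    of [G] between [s = (1 - alpha) r] and [(1 - alpha^2) r] has slope at
    least [s], which concavity forbids if [that < s]. *)

Set Implicit Arguments.
Unset Strict Implicit.
Unset Printing Implicit Defensive.

Import Order.TTheory GRing.Theory Num.Theory.

Local Open Scope ring_scope.

Definition dotp (R : realType) (n : nat) (u v : 'cV[R]_n) : R :=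
  (u^T *m v) 0 0.

Section Euclidean.
Variables (R : realType) (n : nat).
Implicit Types (u v w : 'cV[R]_n) (a : R).

Lemma dotpE u v : dotp u v = \sum_(i < n) u i 0 * v i 0.
Proof. by rewrite /dotp mxE; apply: eq_bigr => i _; rewrite mxE. Qed.

Lemma dotpC u v : dotp u v = dotp v u.
Proof. by rewrite !dotpE; apply: eq_bigr => i _; rewrite mulrC. Qed.

Lemma dotpDr u v w : dotp u (v + w) = dotp u v + dotp u w.
Proof. by rewrite /dotp mulmxDr mxE. Qed.

Lemma dotpZr a u v : dotp u (a *: v) = a * dotp u v.
Proof. by rewrite /dotp -scalemxAr mxE. Qed.

Lemma dotpDl u v w : dotp (v + w) u = dotp v u + dotp w u.
Proof. by rewrite dotpC dotpDr !(dotpC u). Qed.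

Lemma dotpZl a u v : dotp (a *: u) v = a * dotp u v.
Proof. by rewrite dotpC dotpZr dotpC. Qed.

Lemma dotpNr u v : dotp u (- v) = - dotp u v.
Proof. by rewrite -scaleN1r dotpZr mulN1r. Qed.

Lemma dotpNl u v : dotp (- u) v = - dotp u v.
Proof. by rewrite dotpC dotpNr dotpC. Qed.

Lemma dotpp_ge0 u : 0 <= dotp u u.
Proof. by rewrite dotpE sumr_ge0 // => i _; rewrite -expr2 sqr_ge0. Qed.

Lemma dotpp_eq0 u : dotp u u = 0 -> u = 0.
Proof.
rewrite dotpE => /eqP; rewrite psumr_eq0 => [|i _]; last by rewrite -expr2 sqr_ge0.
move=> /allP u0; apply/matrixP => i j; rewrite ord1 mxE.
by have /= := u0 i (mem_index_enum i); rewrite mulf_eq0 orbb => /eqP.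
Qed.

Lemma enorm_ge0 u : 0 <= enorm u.
Proof. exact: sqrtr_ge0. Qed.

Lemma enorm_sqr u : enorm u ^+ 2 = dotp u u.
Proof.
rewrite /enorm sqr_sqrtr; last by apply: sumr_ge0 => i _; rewrite sqr_ge0.
by rewrite dotpE; apply: eq_bigr => i _; rewrite expr2.
Qed.

Lemma enorm_eq0 u : enorm u = 0 -> u = 0.
Proof. by move=> u0; apply: dotpp_eq0; rewrite -enorm_sqr u0 expr0n. Qed.

(** For nonzero norms, the square of the norm of [enorm v *: u - enorm u *: v] equals [2 * enorm u *
    enorm v * (enorm u * enorm v - dotp u v)]. It is nonnegative, so the last factor is too. *)
Lemma cauchy_schwarz u v : dotp u v <= enorm u * enorm v.
Proof.
have [u0|u_neq0] := eqVneq (enorm u) 0.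
  by rewrite u0 mul0r (enorm_eq0 u0) -(scale0r 0) dotpZl mul0r.
have [v0|v_neq0] := eqVneq (enorm v) 0.
  by rewrite v0 mulr0 (enorm_eq0 v0) -(scale0r 0) dotpZr mul0r.
have uv_gt0 : 0 < enorm u * enorm v.
  by rewrite mulr_gt0 // lt_def enorm_ge0 andbT.
have := dotpp_ge0 (enorm v *: u - enorm u *: v).
rewrite !(dotpDl, dotpDr, dotpNl, dotpNr, dotpZl, dotpZr) -!enorm_sqr.
rewrite (dotpC v u) => ge0.
rewrite -subr_ge0 -(pmulr_rge0 _ uv_gt0); nra.
Qed.

Lemma enormZ a u : 0 <= a -> enorm (a *: u) = a * enorm u.
Proof.
move=> a_ge0; apply/eqP; rewrite -(eqrXn2 (n := 2)) ?mulr_ge0 ?enorm_ge0 //.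
by rewrite exprMn !enorm_sqr dotpZl dotpZr mulrA -expr2.
Qed.

Lemma enormD u v : enorm (u + v) <= enorm u + enorm v.
Proof.
rewrite -(ler_pXn2r (n := 2)) ?nnegrE ?addr_ge0 ?enorm_ge0 //.
rewrite sqrrD !enorm_sqr dotpDl !dotpDr (dotpC v u).
have := cauchy_schwarz u v; lra.
Qed.

End Euclidean.

Local Open Scope ereal_scope.

Section Penalized.
Variables (R : realType) (n p : nat) (h : 'cV[R]_p -> \bar R).
Hypothesis h_ge0 : forall b, 0 <= h b.
Hypothesis h_convex : econvex h.

(** Carries convexity from extended reals to reals: between two points where [h] is finite, [h] is
    nonnegative and bounded above, hence finite. *)
Lemma econvex_fine a b t : h a \is a fin_num -> h b \is a fin_num ->
  (0 <= t <= 1)%R ->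
  h (t *: a + (1 - t) *: b)%R \is a fin_num /\
  (fine (h (t *: a + (1 - t) *: b)) <= t * fine (h a) + (1 - t) * fine (h b))%R.
Proof.
move=> fa fb t01; have := h_convex a b t01.
rewrite -{1}(fineK fa) -{1}(fineK fb) -!EFinM -EFinD => le_c.
have fc : h (t *: a + (1 - t) *: b)%R \is a fin_num.
  by rewrite ge0_fin_numE // (le_lt_trans le_c) // ltry.
by split=> //; rewrite -lee_fin fineK.
Qed.

Variables (A : 'M[R]_(n, p)) (z : 'cV[R]_n) (bhat : 'cV[R]_p).
Hypothesis bhat_min : is_argmin (penalized_ls A z h) bhat.

Lemma argmin_fin b : h b \is a fin_num -> h bhat \is a fin_num.
Proof.
move=> fb; have := bhat_min b; rewrite /penalized_ls -(fineK fb) -EFinM -EFinD.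
move: (h_ge0 bhat); case: (h bhat) => [c||] //= _.
by rewrite gt0_muley ?lte_fin // addey // leye_eq.
Qed.

(** First-order optimality: compare the objective at [bhat] with its value at a point moved slightly
    towards [b]. The quadratic term in the step is of second order. *)
Lemma argmin_variational b : h b \is a fin_num ->
  (dotp (z - A *m bhat) (A *m (b - bhat)) <= fine (h b) - fine (h bhat))%R.
Proof.
move=> fb; have fh := argmin_fin fb.
set w := (A *m (b - bhat))%R; set v := (z - A *m bhat)%R.
set D := (fine (h b) - fine (h bhat) - dotp v w)%R.
have step t : (0 < t <= 1)%R -> (0 <= 2 * D + t * dotp w w)%R.
  case/andP=> t_gt0 t_le1.
  have t01 : (0 <= t <= 1)%R by rewrite ltW.
  have [fc le_c] := econvex_fine fb fh t01.
  have := bhat_min (t *: b + (1 - t) *: bhat)%R; rewrite /penalized_ls.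
  rewrite -(fineK fc) -(fineK fh) -!EFinM -!EFinD lee_fin !enorm_sqr.
  have -> : (A *m bhat - z = - v)%R by rewrite opprB.
  have -> : (A *m (t *: b + (1 - t) *: bhat) - z = t *: w - v)%R.
    rewrite /w /v mulmxDr -!scalemxAr mulmxBr scalerBr scalerBl scale1r.
    by rewrite opprB -!addrA; congr (_ + _)%R; rewrite addrCA addrA.
  clearbody v w.
  rewrite !(dotpDl, dotpDr, dotpNl, dotpNr, dotpZl, dotpZr) (dotpC w v) => le_h.
  rewrite -(pmulr_rge0 _ t_gt0) /D; nra.
(* Instead of letting [t] tend to 0, take [t = - D / (K - D)]. If [D < 0], this lies in (0, 1] and
   gives [2 * D + t * K = D * (1 + t) < 0], against [step]. *)
rewrite -subr_ge0 -/D leNgt; apply/negP => D_lt0.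
have K_ge0 := dotpp_ge0 w; set K := dotp w w in step K_ge0.
have KD_gt0 : (0 < K - D)%R by lra.
have tKD : (- D / (K - D) * (K - D) = - D)%R by rewrite divfK // gt_eqF.
have t_gt0 : (0 < - D / (K - D))%R by rewrite divr_gt0 // oppr_gt0.
have t_le1 : (- D / (K - D) <= 1)%R by rewrite ler_pdivrMr // mul1r; lra.
have := step (- D / (K - D))%R; rewrite t_gt0 t_le1 => /(_ isT).
set t := (- D / (K - D))%R in tKD t_gt0 t_le1 *; nra.
Qed.

End Penalized.

Theorem theorem3p3 (R : realType) (n p : nat) (X : 'M[R]_(n, p))
    (bstar : 'cV[R]_p) (eps y : 'cV[R]_n)
    (y_def : y = (X *m bstar + eps)%R)
    (h : 'cV[R]_p -> \bar R)
    (h_ge0 : forall b : 'cV[R]_p, 0 <= h b)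
    (h_convex : econvex h)
    (h_proper : proper_fun h)
    (h_min : forall (A : 'M[R]_(n, p)) (z : 'cV[R]_n),
       exists b : 'cV[R]_p, is_argmin (penalized_ls A z h) b)
    (bhat : 'cV[R]_p)
    (bhat_min : is_argmin (penalized_ls X y h) bhat)
    (h_bstar : h bstar < +oo)
    (alpha r : R) (alpha_itv : (0 < alpha < 1)%R) (r_gt0 : (0 < r)%R)
    (H_le : Hfun X bstar eps h ((1 - alpha) * r)%R
              <= ((1 + alpha ^+ 2) * r)%R%:E)
    (H_ge : r%:E <= Hfun X bstar eps h ((1 - alpha ^+ 2) * r)%R) :
  ((1 - alpha) * r <= enorm (X *m (bhat - bstar)))%R.
Proof.
have /andP[a_gt0 a_lt1] := alpha_itv.
have fstar : h bstar \is a fin_num by rewrite ge0_fin_numE.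
have fhat := argmin_fin h_ge0 bhat_min fstar.
set s := ((1 - alpha) * r)%R in H_le *.
set t2 := ((1 - alpha ^+ 2) * r)%R in H_ge.
pose u b := (X *m (b - bstar))%R; rewrite -/(u bhat).
set that := enorm (u bhat).
have that_ge0 : (0 <= that)%R := enorm_ge0 _.
pose phi b := (dotp eps (u b) + fine (h bstar) - fine (h b))%R.
have s_gt0 : (0 < s)%R by rewrite mulr_gt0 // subr_gt0.
have t2E : t2 = ((1 + alpha) * s)%R by rewrite /t2 /s; ring.
have s_lt_t2 : (s < t2)%R by rewrite t2E; nra.
have t2_gt0 : (0 < t2)%R by lra.
rewrite leNgt; apply/negP => that_lt.
have G_s b : h b \is a fin_num -> (enorm (u b) <= s)%R ->
    (phi b <= (1 + alpha ^+ 2) * r * s)%R.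
  move=> fb b_s; rewrite -ler_pdivrMr // -lee_fin; apply: le_trans H_le.
  apply: ereal_sup_ubound; exists b => //.
  by rewrite -[in LHS](fineK fb) -(fineK fstar).
(* The slope bound for [G] on the chord from [s] to [t2]; dividing by [t2] bounds the second value
   of [H]. *)
suff G_t2 b : h b \is a fin_num -> (enorm (u b) <= t2)%R ->
    (phi b <= (1 + alpha ^+ 2) * r * s + that * (t2 - s))%R.
  have : r%:E <= (((1 + alpha ^+ 2) * r * s + that * (t2 - s)) / t2)%R%:E.
    apply: (le_trans H_ge); apply: ge_ereal_sup => _ [b b_t2 <-].
    (* Where [h b] is infinite the quotient is -oo, so only finite values matter. *)
    have [hb|] := boolP (h b \is a fin_num); last first.
      rewrite ge0_fin_numE // -leNgt leye_eq => /eqP ->.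
      rewrite -(fineK fstar) /= addeNy.
      by rewrite gt0_mulNye ?lte_fin ?invr_gt0 // leNye.
    rewrite -(fineK hb) -(fineK fstar) lee_fin ler_pM2r ?invr_gt0 //.
    exact: G_t2.
  rewrite lee_fin ler_pdivlMr // => r_le.
  (* Here the constants of the hypotheses fit together: [t2 - s = alpha * s], and both sides equal
     [alpha * s ^+ 2]. *)
  have slope : (r * t2 - (1 + alpha ^+ 2) * r * s = s * (t2 - s))%R.
    by rewrite t2E /s; ring.
  have : (that * (t2 - s) < s * (t2 - s))%R by rewrite ltr_pM2r // subr_gt0.
  lra.
move=> fb b_t2.
(* The variational inequality gives [phi b - phi bhat <= dotp (u bhat) (u b) - that ^+ 2];
   Cauchy-Schwarz and [enorm (u b) <= t2] do the rest. *)
have opt : (phi b - phi bhat <= that * (t2 - that))%R.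
  have := argmin_variational h_ge0 h_convex bhat_min fb.
  have -> : (X *m (b - bhat) = u b - u bhat)%R.
    by rewrite /u -mulmxBr opprB addrA subrK.
  have -> : (y - X *m bhat = eps - u bhat)%R.
    by rewrite y_def /u mulmxBr opprB addrA; congr (_ - _)%R; rewrite addrC.
  rewrite !(dotpDl, dotpDr, dotpNl, dotpNr) -enorm_sqr -/that => le_h.
  have := cauchy_schwarz (u bhat) (u b); rewrite -/that => cs.
  have : (that * enorm (u b) <= that * t2)%R by rewrite ler_wpM2l.
  rewrite /phi; lra.
have t2that_gt0 : (0 < t2 - that)%R by lra.
(* The weight for which [lam * t2 + (1 - lam) * that = s]. *)
pose lam := ((s - that) / (t2 - that))%R.
have lamE : (lam * (t2 - that) = s - that)%R by rewrite divfK // gt_eqF.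
have lam_ge0 : (0 <= lam)%R by rewrite divr_ge0 // ltW // subr_gt0.
have lam_le1 : (lam <= 1)%R by rewrite ler_pdivrMr // mul1r; lra.
have lam01 : (0 <= lam <= 1)%R by rewrite lam_ge0.
have [fc le_c] := econvex_fine h_ge0 h_convex fb fhat lam01.
set c := (lam *: b + (1 - lam) *: bhat)%R in fc le_c.
have uc : u c = (lam *: u b + (1 - lam) *: u bhat)%R.
  rewrite /u !scalemxAr -mulmxDr; congr (_ *m _)%R.
  rewrite !scalerBr addrACA -opprD -scalerDl.
  by rewrite (_ : lam + (1 - lam) = 1)%R ?scale1r //; ring.
(* By the choice of [lam], the triangle inequality puts [c] in the ball of radius [s], where [G_s]
   applies. *)
have c_s : (enorm (u c) <= s)%R.
  rewrite uc; apply: (le_trans (enormD _ _)).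
  rewrite !enormZ ?subr_ge0 // -/that.
  have := ler_wpM2l lam_ge0 b_t2; lra.
have := G_s c fc c_s.
have : (lam * phi b + (1 - lam) * phi bhat <= phi c)%R.
  by rewrite /phi uc dotpDr !dotpZr; lra.
have lam1_ge0 : (0 <= 1 - lam)%R by lra.
(* Concavity gives [phi b <= phi c + (1 - lam) * (phi b - phi bhat)]. Since
   [(1 - lam) * (t2 - that) = t2 - s], the last term is at most [that * (t2 - s)]. *)
have := ler_wpM2l lam1_ge0 opt.
have -> : ((1 - lam) * (that * (t2 - that)) = that * (t2 - s))%R.
  have -> : s = (lam * (t2 - that) + that)%R by lra.
  ring.
lra.
Qed.
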